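(* Let $w_1,\dots,w_n$ be positive real numbers, let $H_{\mathfrak W}=\prod_{k=1}^n\{0,w_k\}\subseteq\mathbb R^n$ be the weighted Hamming cube with the metric induced by the $\ell^1$ norm $\|\cdot\|_1$, and let $(X,d)$ be a metric subspace of $(H_{\mathfrak W},\|\cdot\|_1)$ with at least two points. Then the following are equivalent: (1) $X$ is affinely independent (as a subset of the real vector space $\mathbb R^n$). (2) The distance matrix $D_X$ is invertible. (3) $(X,d)$ is of strict $1$-negative type. (4) The supremal $p$-negative type of $(X,d)$ is greater than $1$. (5) The maximal generalized roundness of $(X,d)$ is greater than $1$. (6) The $1$-negative type gap $\Gamma_1(X)$ of $(X,d)$ is positive. (7) There are no nontrivial $1$-polygonal equalities in $(X,d)$.
   Context: Let $(X,d)$ be a finite metric space with (distinct) points $x_0,\dots,x_m$. For $p\ge 0$, $D_p=D_{X,p}=(d(x_i,x_j)^p)_{i,j=0}^m$ (with $d(x,x)^0=0$), and $D_X=D_{X,1}$ is the distance matrix. $\langle\cdot,\cdot\rangle$ is the usual inner product, $\mathbf 1$ is the all-ones vector, and $F_0=\{\boldsymbol\xi\in\mathbb R^{m+1}:\langle\boldsymbol\xi,\mathbf 1\rangle=0\}$. $(X,d)$ is of $p$-negative type if $\langle D_p\boldsymbol\xi,\boldsymbol\xi\rangle=\sum_{i,j}d(x_i,x_j)^p\xi_i\xi_j\le 0$ for all $\boldsymbol\xi\in F_0$; it is of strict $p$-negative type if moreover the inequality is strict for all nonzero $\boldsymbol\xi\in F_0$. The supremal $p$-negative type of $(X,d)$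 is $\sup\{p\ge 0: (X,d)\text{ is of }p\text{-negative type}\}\in[0,\infty]$. $(X,d)$ has generalized roundness $p\ge 0$ if $\sum_{i<j}d(a_i,a_j)^p+\sum_{i<j}d(b_i,b_j)^p\le\sum_{i,j}d(a_i,b_j)^p$ for all finite lists $[a_1,\dots,a_N]$, $[b_1,\dots,b_N]$ of (not necessarily distinct) elements of $X$. The maximal generalized roundness is $\sup\{p\ge 0:(X,d)\text{ has generalized roundness }p\}\in[0,\infty]$. Every subset of $(\mathbb R^n,\|\cdot\|_1)$ is of $1$-negative type. For a finite metric space of $p$-negative type, the $p$-negative type gap $\Gamma_p(X)$ is the largest constant $\Gamma\ge 0$ such that $\Gamma\|\boldsymbol\xi\|_1^2+2\langle D_p\boldsymbol\xi,\boldsymbol\xi\rangle\le 0$ for all $\boldsymbol\xi\in F_0$. A finite metric space $(X,d)$ admits a nontrivial $p$-polygonal equality if and only if $\langle D_p\boldsymbol\xi,\boldsymbol\xi\rangle=0$ for some nonzero $\boldsymbol\xi\in F_0$; this is the form of the notion to be used. *)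

(* Defs.v *)
From HB Require Import structures.
From mathcomp Require Import all_boot all_order all_algebra.
From mathcomp Require Import all_classical all_reals all_analysis.

Set Implicit Arguments.
Unset Strict Implicit.
Unset Printing Implicit Defensive.

Import Order.TTheory GRing.Theory Num.Theory.

Local Open Scope classical_set_scope.
Local Open Scope ring_scope.

Definition inner {R : realType} {n : nat} (u v : 'cV[R]_n) : R :=
  \sum_(i < n) u i 0 * v i 0.

(* MathComp-Analysis equips matrices with the max norm `|v|, not this one. *)
Definition l1norm {R : realType} {n : nat} (v : 'cV[R]_n) : R :=
  \sum_(i < n) `|v i 0|.

Definition hamming_cube {R : realType} {n : nat} (w : 'I_n -> R) :
    set 'cV[R]_n :=
  [set v | forall k : 'I_n, v k 0 = 0 \/ v k 0 = w k].

(* The points x_0, ..., x_m are affinely independent when the differences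
   x_1 - x_0, ..., x_m - x_0 are linearly independent. *)
Definition affinely_independent {R : realType} {n m : nat}
    (x : 'I_m.+1 -> 'cV[R]_n) : bool :=
  free [seq x (lift ord0 i) - x ord0 | i <- enum 'I_m].

(* In what follows a finite metric space with N distinct points is given by the
   function d : 'I_N -> 'I_N -> R of the distances between these points. *)

(* The case i == j only matters for p = 0: the convention is d(x, x)^0 = 0,
   whereas 0 `^ 0 = 1. *)
Definition pdist {R : realType} {N : nat} (d : 'I_N -> 'I_N -> R) (p : R)
    (i j : 'I_N) : R :=
  if i == j then 0 else d i j `^ p.

Definition dist_mx {R : realType} {N : nat} (d : 'I_N -> 'I_N -> R) (p : R) :
    'M[R]_N :=
  \matrix_(i, j) pdist d p i j.

Definition F0 {R : realType} {N : nat} : set 'cV[R]_N :=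
  [set xi | inner xi (const_mx 1) = 0].

Definition negative_type {R : realType} {N : nat} (d : 'I_N -> 'I_N -> R)
    (p : R) : Prop :=
  forall xi : 'cV[R]_N, F0 xi -> inner (dist_mx d p *m xi) xi <= 0.

Definition strict_negative_type {R : realType} {N : nat}
    (d : 'I_N -> 'I_N -> R) (p : R) : Prop :=
  negative_type d p /\
  forall xi : 'cV[R]_N, F0 xi -> xi <> 0 ->
    inner (dist_mx d p *m xi) xi < 0.

Definition supremal_negative_type {R : realType} {N : nat}
    (d : 'I_N -> 'I_N -> R) : \bar R :=
  ereal_sup [set p%:E | p in [set p : R | 0 <= p /\ negative_type d p]].

Definition generalized_roundness {R : realType} {N : nat}
    (d : 'I_N -> 'I_N -> R) (p : R) : Prop :=
  forall (k : nat) (a b : 'I_k -> 'I_N),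
    \sum_(i < k) \sum_(j < k | (i < j)%N) pdist d p (a i) (a j) +
    \sum_(i < k) \sum_(j < k | (i < j)%N) pdist d p (b i) (b j)
    <= \sum_(i < k) \sum_(j < k) pdist d p (a i) (b j).

Definition maximal_generalized_roundness {R : realType} {N : nat}
    (d : 'I_N -> 'I_N -> R) : \bar R :=
  ereal_sup
    [set p%:E | p in [set p : R | 0 <= p /\ generalized_roundness d p]].

Definition gap_constant {R : realType} {N : nat} (d : 'I_N -> 'I_N -> R)
    (p G : R) : Prop :=
  0 <= G /\
  forall xi : 'cV[R]_N, F0 xi ->
    G * l1norm xi ^+ 2 + 2 * inner (dist_mx d p *m xi) xi <= 0.

(* Stated as a relation because the largest constant exists only for spaces of
   p-negative type with at least two points. *)
Definition is_negative_type_gap {R : realType} {N : nat}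
    (d : 'I_N -> 'I_N -> R) (p G : R) : Prop :=
  gap_constant d p G /\ forall G' : R, gap_constant d p G' -> G' <= G.

Definition nontrivial_polygonal_equality {R : realType} {N : nat}
    (d : 'I_N -> 'I_N -> R) (p : R) : Prop :=
  exists xi : 'cV[R]_N,
    [/\ F0 xi, xi <> 0 & inner (dist_mx d p *m xi) xi = 0].

(* Main.v *)
Require Import Defs.
From HB Require Import structures.
From mathcomp Require Import all_boot all_order all_algebra.
From mathcomp Require Import all_classical all_reals all_analysis.
From mathcomp Require Import measurable_realfun ring lra.

Set Implicit Arguments.
Unset Strict Implicit.
Unset Printing Implicit Defensive.

Import Order.TTheory GRing.Theory Num.Theory.
Import numFieldNormedType.Exports.

Local Open Scope classical_set_scope.
Local Open Scope ring_scope.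

(** For a vector [v] of sum zero, let [y k] be the [k]-th coordinate of
    [\sum_j v j *: x j].  On the cube [|s - t| = s + t - 2 s t / w k] for coordinates
    [s, t] in [{0, w k}], so that

      (D v) i = \sum_k y k * (1 - 2 * x i k / w k),
      <D v, v> = - 2 * \sum_k y k ^ 2 / w k.

    Hence the space is of 1-negative type, and for [v] of sum zero the vanishing of
    the form, an affine dependence [\sum_j v j *: x j = 0], and [D v = 0] are all the
    same: this is [cube_form_eq0] and [cube_unitmx_strict_negative_type].  In any
    finite metric space with two points, strict 1-negative type makes [D] invertible
    ([strict_negative_type_unitmx]).  On the cube the inverse of [D], together with
    the fact that the entries of [D v] are signed sums of the [y k], bounds [v] by
    the form, which yields a positive gap ([cube_unitmx_gap]).  A positive gap
    persists for exponents slightly above 1 ([gap_constant_negative_type_gt1]).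

    Generalized roundness [p] is [p]-negative type restricted to integer vectors, and
    extends to real vectors by approximation ([roundness_negative_type]), so the two
    suprema agree.

    It remains to see that [p]-negative type for some [p > 1] implies that 1-negative
    type is strict ([negative_type_gt1_nondegenerate]).  This rests on
    Schoenberg's theorem: if [d `^ p] is of negative type then [expR (- s * d `^ p)]
    is positive semidefinite ([psd_expRN], from the Schur product theorem
    [psd_schur]), and [d] is a positive mixture of the functions
    [1 - expR (- s * d `^ p)]. *)

(** * Bilinear forms of kernels on a finite set *)

Definition bform {R : realType} {I : finType} (K : I -> I -> R)
    (u v : I -> R) : R :=
  \sum_i \sum_j K i j * (u i * v j).

Definition psd {R : realType} {I : finType} (K : I -> I -> R) : Prop :=
  forall v, 0 <= bform K v v.

Section BilinearForm.
Context {R : realType} {I : finType}.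
Implicit Types (K A : I -> I -> R) (u v w : I -> R) (t : R).

Lemma eq_bform K A u v : (forall i j, K i j = A i j) -> bform K u v = bform A u v.
Proof.
by move=> KA; apply: eq_bigr => i _; apply: eq_bigr => j _; rewrite KA.
Qed.

Lemma bformC K u v : (forall i j, K i j = K j i) -> bform K u v = bform K v u.
Proof.
move=> sK; rewrite /bform exchange_big /=; apply: eq_bigr => i _.
by apply: eq_bigr => j _; rewrite sK [u j * _]mulrC.
Qed.

Lemma bformDZl K u v w t :
  bform K (fun i => u i + t * v i) w = bform K u w + t * bform K v w.
Proof.
rewrite /bform mulr_sumr -big_split /=; apply: eq_bigr => i _.
by rewrite mulr_sumr -big_split /=; apply: eq_bigr => j _; ring.
Qed.

Lemma sum_delta a : \sum_(i : I) (i == a)%:R = 1 :> R.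
Proof.
rewrite (bigD1 a) //= eqxx big1 ?addr0 // => i ia.
by rewrite (negbTE ia).
Qed.

Lemma bform_deltal K a v :
  bform K (fun i => (i == a)%:R) v = \sum_j K a j * v j.
Proof.
rewrite /bform (bigD1 a) //= [X in _ + X]big1 ?addr0 => [|i ia].
  by apply: eq_bigr => j _; rewrite eqxx mul1r.
by rewrite big1 // => j _; rewrite (negbTE ia) mul0r mulr0.
Qed.

Lemma bform_delta K a b :
  bform K (fun i => (i == a)%:R) (fun i => (i == b)%:R) = K a b.
Proof.
rewrite bform_deltal (bigD1 b) //= eqxx mulr1 big1 ?addr0 // => j jb.
by rewrite (negbTE jb) mulr0.
Qed.

Lemma bform_kerneldiff K A u v :
  bform (fun i j => K i j - A i j) u v = bform K u v - bform A u v.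
Proof.
rewrite /bform -sumrB; apply: eq_bigr => i _; rewrite -sumrB.
by apply: eq_bigr => j _; ring.
Qed.

Lemma qformDZ K u v t : (forall i j, K i j = K j i) ->
  bform K (fun i => u i + t * v i) (fun i => u i + t * v i) =
  bform K u u + 2 * t * bform K u v + t ^+ 2 * bform K v v.
Proof.
move=> sK; rewrite bformDZl (bformC u) // (bformC v) // !bformDZl.
by rewrite (bformC v u) //; ring.
Qed.

(** Otherwise the form takes the value [-1] at [e_j - t e_a] for
    [t = (K j j + 1) / (2 K a j)]. *)
Lemma psd_diag0 K a j : (forall i j, K i j = K j i) -> psd K ->
  K a a = 0 -> K a j = 0.
Proof.
move=> sK pK Kaa; apply/eqP/negPn/negP => Kaj0.
have := pK (fun i => (i == j)%:R + (- ((K j j + 1) / (2 * K a j))) * (i == a)%:R).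
rewrite qformDZ // !bform_delta Kaa mulr0 addr0 (sK j a).
have -> : 2 * - ((K j j + 1) / (2 * K a j)) * K a j = - (K j j + 1) by field.
lra.
Qed.

(** One step of symmetric Gaussian elimination.  When [K a a = 0], the row
    [K a] vanishes, and the convention [0^-1 = 0] makes the step trivial. *)
Lemma psd_elim K a : (forall i j, K i j = K j i) -> psd K ->
  psd (fun i j => K i j - K i a * K a j / K a a).
Proof.
move=> sK pK v.
have [Kaa|Kaa] := eqVneq (K a a) 0.
  rewrite (_ : bform _ v v = bform K v v) //; apply: eq_bform => i j.
  by rewrite Kaa invr0 mulr0 subr0.
set s := \sum_j K a j * v j.
have := pK (fun i => v i + (- (s / K a a)) * (i == a)%:R).
rewrite qformDZ // (bformC v) // bform_deltal -/s bform_delta.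
rewrite bform_kerneldiff (_ : bform (fun i j => K i a * K a j / K a a) v v =
    s ^+ 2 / K a a).
  by move=> h; apply: (le_trans h); rewrite le_eqVlt; apply/orP; left; apply/eqP; field.
rewrite expr2 /s mulr_suml mulr_suml; apply: eq_bigr => i _.
by rewrite mulr_sumr mulr_suml; apply: eq_bigr => j _; rewrite (sK i a); ring.
Qed.

(** Schur product theorem.  Each elimination step splits off a rank one part
    [K i a * K a j / K a a], whose product with [A] is, up to a positive factor,
    the form of [A] in rescaled variables; what is left vanishes on one more
    row. *)
Lemma psd_schur K A : (forall i j, K i j = K j i) -> psd K -> psd A ->
  psd (fun i j => K i j * A i j).
Proof.
move=> + + pA.
have : forall i j, i \notin enum I -> K i j = 0 by move=> i j; rewrite mem_enum.
elim: (enum I) K => [|a s IHs] K suppK sK pK v.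
  by rewrite /bform big1 // => i _; rewrite big1 //= => j _; rewrite suppK // !mul0r.
have rowa j : K a a = 0 -> K a j = 0 by apply: psd_diag0.
have Kaa0 : 0 <= K a a by rewrite -(bform_delta K a a).
pose K' i j := K i j - K i a * K a j / K a a.
have pK' : psd (fun i j => K' i j * A i j).
  apply: IHs; [| |exact: psd_elim].
  - move=> i j ns; rewrite /K'; have [->|ia] := eqVneq i a.
      have [Kaa|Kaa] := eqVneq (K a a) 0; first by rewrite (rowa j Kaa) Kaa !mul0r subrr.
      by field.
    have nas : i \notin a :: s by rewrite inE negb_or ia.
    by rewrite (suppK i j nas) (suppK i a nas) !mul0r subrr.
  - by move=> i j; rewrite /K' (sK i j) (sK i a) (sK a j); ring.
rewrite (_ : bform _ v v = bform (fun i j => K' i j * A i j) v v +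
    (K a a)^-1 * bform A (fun i => K i a * v i) (fun i => K i a * v i)).
  by rewrite addr_ge0 ?mulr_ge0 ?invr_ge0.
rewrite /bform mulr_sumr -big_split /=; apply: eq_bigr => i _.
rewrite mulr_sumr -big_split /=; apply: eq_bigr => j _.
by rewrite /K' (sK j a); ring.
Qed.

Lemma psdZ K t : 0 <= t -> psd K -> psd (fun i j => t * K i j).
Proof.
move=> t0 pK v; rewrite (_ : bform _ v v = t * bform K v v) ?mulr_ge0 //.
rewrite /bform mulr_sumr; apply: eq_bigr => i _; rewrite mulr_sumr.
by apply: eq_bigr => j _; rewrite -mulrA.
Qed.

Lemma psdD K A : psd K -> psd A -> psd (fun i j => K i j + A i j).
Proof.
move=> pK pA v.
rewrite (_ : bform _ v v = bform K v v + bform A v v) ?addr_ge0 //.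
rewrite /bform -big_split; apply: eq_bigr => i _; rewrite -big_split.
by apply: eq_bigr => j _; rewrite mulrDl.
Qed.

Lemma psd1 : psd (fun _ _ : I => 1 : R).
Proof.
move=> v; rewrite (_ : bform _ v v = (\sum_i v i) ^+ 2) ?sqr_ge0 //.
rewrite expr2 mulr_suml; apply: eq_bigr => i _; rewrite mulr_sumr.
by apply: eq_bigr => j _; rewrite mul1r.
Qed.

Lemma psdX K n : (forall i j, K i j = K j i) -> psd K ->
  psd (fun i j => K i j ^+ n).
Proof.
move=> sK pK; elim: n => [|n IHn]; first exact: psd1.
have -> : (fun i j => K i j ^+ n.+1) = (fun i j => K i j * K i j ^+ n).
  by apply/funext => i; apply/funext => j; rewrite exprS.
exact: psd_schur.
Qed.

(** The partial sums of the exponential series are nonnegative combinations of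
    entrywise powers, and the cone of positive semidefinite kernels is closed. *)
Lemma psd_expR K : (forall i j, K i j = K j i) -> psd K ->
  psd (fun i j => expR (K i j)).
Proof.
move=> sK pK v.
pose S n := bform (fun i j => series (exp_coeff (K i j)) n) v v.
have S0 n : 0 <= S n.
  suff : psd (fun i j => series (exp_coeff (K i j)) n) by apply.
  elim: n => [|n IHn].
    move=> u; rewrite /bform big1 // => i _; rewrite big1 // => j _.
    by rewrite /series /= big_geq // mul0r.
  rewrite (_ : (fun i j => _) = fun i j => series (exp_coeff (K i j)) n +
    (n`!%:R)^-1 * K i j ^+ n); last first.
    apply/funext => i; apply/funext => j.
    by rewrite /series /= big_nat_recr //= /exp_coeff /= mulrC.
  by apply: psdD => //; apply: psdZ; [rewrite invr_ge0|exact: psdX].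
have Scvg : S n @[n --> \oo] --> bform (fun i j => expR (K i j)) v v.
  apply: cvg_big => [|i _]; first exact: add_continuous.
  apply: cvg_big => [|j _]; first exact: add_continuous.
  by apply: cvgMr_tmp; exact: is_cvg_series_exp_coeff.
rewrite -(cvg_lim _ Scvg) //; apply: limr_ge; first by apply/cvg_ex; eexists; exact: Scvg.
exact: nearW.
Qed.

End BilinearForm.

(** * Negative type in coordinates *)

Lemma inner_dist_mx {R : realType} {N : nat} (d : 'I_N -> 'I_N -> R) p
    (xi : 'cV[R]_N) :
  inner (dist_mx d p *m xi) xi =
  bform (pdist d p) (fun i => xi i 0) (fun i => xi i 0).
Proof.
apply: eq_bigr => i _; rewrite mxE mulr_suml; apply: eq_bigr => j _.
by rewrite mxE -mulrA [xi j 0 * _]mulrC.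
Qed.

Lemma inner_dist_mx_col {R : realType} {N : nat} (d : 'I_N -> 'I_N -> R) p
    (v : 'I_N -> R) :
  inner (dist_mx d p *m (\col_i v i)) (\col_i v i) = bform (pdist d p) v v.
Proof.
rewrite inner_dist_mx.
by apply: eq_bigr => i _; apply: eq_bigr => j _; rewrite /= !mxE.
Qed.

Lemma F0E {R : realType} {N : nat} (xi : 'cV[R]_N) :
  F0 xi <-> \sum_i xi i 0 = 0.
Proof.
have <- : inner xi (const_mx 1) = \sum_i xi i 0.
  by apply: eq_bigr => i _; rewrite mxE mulr1.
by [].
Qed.

Lemma F0_col {R : realType} {N : nat} (v : 'I_N -> R) :
  \sum_i v i = 0 -> F0 (\col_i v i).
Proof. by move=> v0; apply/F0E; under eq_bigr do rewrite mxE. Qed.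

Lemma negative_typeP {R : realType} {N : nat} (d : 'I_N -> 'I_N -> R) p :
  negative_type d p <->
  forall v, \sum_i v i = 0 -> bform (pdist d p) v v <= 0.
Proof.
split=> [nt v /F0_col/nt|nt xi /F0E xi0]; first by rewrite inner_dist_mx_col.
by rewrite inner_dist_mx nt.
Qed.

Lemma strict_negative_typeP {R : realType} {N : nat} (d : 'I_N -> 'I_N -> R) p :
  strict_negative_type d p <->
  negative_type d p /\
  forall v, \sum_i v i = 0 -> bform (pdist d p) v v = 0 -> forall i, v i = 0.
Proof.
split=> [[nt st]|[nt nondeg]]; split=> //.
  move=> v v0 Qv i; apply/eqP/negPn/negP => vi.
  have := st _ (F0_col v0); rewrite inner_dist_mx_col Qv ltxx => h.
  suff : false by [].
  by apply: h => /matrixP/(_ i 0)/eqP; rewrite !mxE (negbTE vi).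
move=> xi xiF xi0; rewrite lt_neqAle nt // andbT inner_dist_mx.
apply/eqP => Q0; apply: xi0; apply/colP => i; rewrite mxE.
by apply: (nondeg (fun i => xi i 0)) => //; exact/F0E.
Qed.

Lemma pdist_sym {R : realType} {N : nat} (d : 'I_N -> 'I_N -> R) p :
  (forall i j, d i j = d j i) -> forall i j, pdist d p i j = pdist d p j i.
Proof. by move=> sd i j; rewrite /pdist eq_sym sd. Qed.

Lemma pdist_diag {R : realType} {N : nat} (d : 'I_N -> 'I_N -> R) p i :
  pdist d p i i = 0.
Proof. by rewrite /pdist eqxx. Qed.

Lemma pdist1 {R : realType} {N : nat} (d : 'I_N -> 'I_N -> R) :
  (forall i, d i i = 0) -> (forall i j, i != j -> 0 < d i j) ->
  pdist d 1 = d.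
Proof.
move=> d0 dgt0; apply/funext => i; apply/funext => j; rewrite /pdist.
by have [->|/dgt0 ij] := eqVneq i j; [rewrite d0|rewrite powRr1// ltW].
Qed.

(** * Negative type for an exponent above 1 forces strictness at 1 *)

(** Schoenberg: with a base point [a], the kernel
    [K i j = e i a + e a j - e i j] is positive semidefinite, and
    [expR (- s e)] is [expR (s K)] up to the rescaling of coordinates by
    [expR (- s (e a i))]. *)
Lemma psd_expRN {R : realType} {I : finType} (e : I -> I -> R) (a : I) (s : R) :
  (forall i j, e i j = e j i) -> e a a = 0 ->
  (forall v, \sum_i v i = 0 -> bform e v v <= 0) -> 0 <= s ->
  psd (fun i j => expR (- (s * e i j))).
Proof.
move=> se eaa nte s0 v.
pose K i j := e i a + e a j - e i j.
have sK i j : K i j = K j i by rewrite /K (se i j) (se i a) (se a j); ring.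
have pK : psd K.
  move=> u; pose S := \sum_i u i.
  have uS : \sum_i (u i + (- S) * (i == a)%:R) = 0.
    by rewrite big_split -mulr_sumr /= sum_delta mulr1 subrr.
  have := nte _ uS.
  rewrite qformDZ // (bformC u) // bform_deltal bform_delta eaa.
  have -> : bform K u u = 2 * S * (\sum_j e a j * u j) - bform e u u.
    rewrite bform_kerneldiff; congr (_ - _).
    rewrite [LHS](_ : _ = (\sum_i e a i * u i) * S + S * \sum_j e a j * u j).
      by ring.
    rewrite /S !mulr_suml -big_split; apply: eq_bigr => i _ /=.
    rewrite !mulr_sumr -big_split; apply: eq_bigr => j _ /=.
    by rewrite (se i a); ring.
  lra.
rewrite (_ : bform _ v v = bform (fun i j => expR (s * K i j))
    (fun i => expR (- (s * e a i)) * v i) (fun i => expR (- (s * e a i)) * v i)).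
  apply: psd_expR => [i j|]; first by rewrite sK.
  exact: psdZ.
apply: eq_bigr => i _; apply: eq_bigr => j _.
have -> : - (s * e i j) = s * K i j + (- (s * e a i)) + (- (s * e a j)).
  by rewrite /K (se i a); ring.
by rewrite !expRD; ring.
Qed.

(** For [p > 1] the function [1 - expR (- v `^ (- p))] is bounded near [0] and at
    most [v `^ (- p)] near infinity; its integral over [0, +oo[ is thus finite. *)
Lemma stretched_primitive {R : realType} (p : R) : 1 < p ->
  exists G : R -> R,
  [/\ forall v : R, 0 < v -> is_derive v 1 G (1 - expR (- (v `^ (- p)))),
      forall v : R, 0 < v -> 0 <= G v <= v &
      exists L : R, G v @[v --> +oo] --> L].
Proof.
move=> p1.
pose f (v : R) : R := 1 - expR (- (v `^ (- p))).
have f0 (v : R) : 0 <= f v by rewrite /f subr_ge0 expR_le1 // oppr_le0 powR_ge0.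
have f1 (v : R) : f v <= 1 by rewrite /f lerBlDr lerDl expR_ge0.
have mf : measurable_fun setT f.
  apply: measurable_funB => //; apply: measurableT_comp => //.
  by apply: measurableT_comp => //; exact: measurable_powR.
have itv_fin (v : R) : (lebesgue_measure (`[0%R, v] : set R) < +oo)%E.
  by rewrite lebesgue_measure_itv /=; case: ifP => // _; rewrite ltry.
have itv_len (v : R) : 0 <= v ->
    fine (lebesgue_measure (`[0%R, v] : set R)) = v.
  rewrite lebesgue_measure_itv /= lte_fin le_eqVlt => /predU1P[<-|v0].
    by rewrite ltxx.
  by rewrite v0 /= oppr0 addr0.
have intf (v : R) : lebesgue_measure.-integrable `[0, v] (EFin \o f).
  apply: measurable_bounded_integrable => //.
  - exact: itv_fin.
  - exact: measurable_funTS.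
  - exists 1; split; first exact: num_real.
    by move=> M M1 x _ /=; rewrite ger0_norm // (le_trans (f1 x)) // ltW.
pose G v : R := (\int[lebesgue_measure]_(t in `[0, v]) f t)%R.
have dG (v : R) : 0 < v -> is_derive v 1 G (f v).
  move=> v0.
  have vv1 : v < v + 1 by rewrite ltrDl.
  have cf : {for v, continuous f}.
    apply: cvgB; first exact: cvg_cst.
    apply: continuous_comp; last exact: continuous_expR.
    apply: continuousN; apply: differentiable_continuous.
    by apply/derivable1_diffP; apply: derivable_powR; rewrite in_itv /= v0.
  have [d1 d2] := continuous_FTC1_closed vv1 (intf _) v0 cf.
  by split => //; rewrite -derive1E d2.
have G0 (v : R) : 0 <= G v by exact: Rintegral_ge0.
have Gle (v : R) : 0 <= v -> G v <= v.
  move=> v0; rewrite /G.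
  rewrite -[leRHS]mul1r -[in leRHS](itv_len _ v0) -Rintegral_cst //.
  apply: le_Rintegral => //.
  apply: measurable_bounded_integrable => //.
  - exact: itv_fin.
  - exists 1; split; first exact: num_real.
    by move=> M M1 x _ /=; rewrite normr1 ltW.
have Gnd : nondecreasing_fun G.
  move=> v u vu; rewrite /G /Rintegral fine_le //.
  - by apply: integrable_fin_num => //; exact: intf.
  - by apply: integrable_fin_num => //; exact: intf.
  - apply: ge0_subset_integral => //.
    + by apply/measurable_EFinP; exact: measurable_funTS.
    + by move=> x _; rewrite lee_fin.
    + by apply: subset_itvl; rewrite bnd_simp.
exists G; split => //; first by move=> v v0; rewrite G0 Gle // ltW.
exists (sup (range G)); apply: nondecreasing_cvgr => //.
exists (G 1 + (p - 1)^-1) => _ [v _ <-].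
have [v1|/ltW v1] := leP v 1.
  by rewrite (le_trans (Gnd _ _ v1)) // lerDl invr_ge0 subr_ge0 ltW.
pose H (v : R) := G v + v `^ (1 - p) / (p - 1).
have dH (x : R) : 0 < x -> is_derive x 1 H (f x - x `^ (- p)).
  move=> x0; have dGx := dG x x0.
  have -> : f x - x `^ (- p) = f x + (p - 1)^-1 *: ((1 - p) * x `^ (1 - p - 1)).
    rewrite [1 - p - 1](_ : _ = - p); last by ring.
    by rewrite /GRing.scale /=; field; lra.
  rewrite (_ : H = G + (p - 1)^-1 \*: (@powR R ^~ (1 - p))); last first.
    by apply/funext => y; rewrite /H mulrC.
  by apply: is_deriveD; apply: is_deriveZ; exact: is_derive1_powR.
have : H v <= H 1.
  apply: (@ler0_derive1_nincry _ H 1) => //.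
  - by move=> x; rewrite in_itv /= andbT => x1; have [] := dH x (lt_trans ltr01 x1).
  - move=> x; rewrite in_itv /= andbT => x1.
    rewrite derive1E; have [_ ->] := dH x (lt_trans ltr01 x1).
    have := expR_ge1Dx (- (x `^ (- p))); rewrite /f; lra.
  - apply: continuous_in_subspaceT => x; rewrite inE /= in_itv /= andbT => x1.
    apply: differentiable_continuous; apply/derivable1_diffP.
    by have [] := dH x (lt_le_trans ltr01 x1).
rewrite /H powR1 mul1r; apply: le_trans; rewrite lerDl mulr_ge0 ?powR_ge0 //.
by rewrite invr_ge0 subr_ge0 ltW.
Qed.

(** The substitution [u = d t] gives
    [d * C = \int_0^+oo (1 - expR (- (d / u) `^ p)) du], where the constant
    [C = \int_0^+oo (1 - expR (- t `^ (- p))) dt] is finite because [p > 1].  For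
    [v] of sum zero this makes [bform d v v] a negative multiple of the integral
    over [u] of the form of the kernel [E u i j = expR (- (d i j / u) `^ p)].  By
    [psd_expRN] that form is nonnegative, and it is positive for small [u] unless
    [v = 0], since [E u] tends to the identity.  In place of the integral the proof
    uses a primitive [P] of [u |-> - bform (E u) v v]: it tends to [0] at [0] and
    to a multiple of [bform d v v] at infinity.  When the latter is [0], the
    monotone function [P] vanishes, and so does its derivative. *)
Lemma negative_type_gt1_nondegenerate {R : realType} {N : nat}
    (d : 'I_N -> 'I_N -> R) (p : R) :
  (forall i j, d i j = d j i) -> (forall i, d i i = 0) ->
  (forall i j, i != j -> 0 < d i j) -> 1 < p -> negative_type d p ->
  forall v, \sum_i v i = 0 -> bform d v v = 0 -> forall i, v i = 0.
Proof.
move=> sd d0 dgt0 p1 /negative_typeP ntp v v0 Qv a.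
have [G [dG G0v [L GL]]] := stretched_primitive p1.
pose E (u : R) i j := expR (- (u `^ (- p) * pdist d p i j)).
pose P (u : R) : R := \sum_i \sum_j v i * v j * d i j * G (u / d i j).
have E_ge0 (u : R) : 0 <= bform (E u) v v.
  have := psd_expRN (pdist_sym p sd) (pdist_diag d p a) ntp; apply.
  exact: powR_ge0.
have dP (u : R) : 0 < u -> is_derive u 1 P (- bform (E u) v v).
  move=> u0.
  have -> : - bform (E u) v v = \sum_i \sum_j v i * v j * (1 - E u i j).
    transitivity ((\sum_i v i) ^+ 2 - bform (E u) v v).
      by rewrite v0 expr0n sub0r.
    rewrite expr2 mulr_suml -sumrB; apply: eq_bigr => i _.
    by rewrite mulr_sumr -sumrB; apply: eq_bigr => j _; ring.
  have -> : P = \sum_i \sum_j (fun u => v i * v j * d i j * G (u / d i j)).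
    by apply/funext => x; rewrite /P fct_sumE; apply: eq_bigr => i _; rewrite fct_sumE.
  apply: is_derive_sum => i; apply: is_derive_sum => j.
  rewrite /E /pdist; have [->|ij] := eqVneq i j.
    rewrite d0 !mulr0 oppr0 expR0 subrr mulr0.
    under eq_fun do rewrite mul0r.
    exact: is_derive_cst.
  have dij := dgt0 _ _ ij.
  have dGu := dG (u / d i j) (divr_gt0 u0 dij).
  have -> : u `^ (- p) * d i j `^ p = (u / d i j) `^ (- p).
    rewrite powRM ?invr_ge0 ?ltW // -powR_inv1 ?ltW // -powRrM.
    by rewrite mulrNN mul1r.
  have -> : v i * v j * (1 - expR (- ((u / d i j) `^ (- p)))) =
      (v i * v j * d i j) *: ((d i j)^-1 *: (1 - expR (- ((u / d i j) `^ (- p))))).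
    by rewrite /GRing.scale /=; field; rewrite gt_eqF.
  rewrite (_ : (fun x => _) = (v i * v j * d i j) \*: (fun x : R => G (x / d i j))) //.
  apply: is_deriveZ.
  rewrite /GRing.scale /= mulrC.
  apply: (@is_derive1_comp _ G (fun x => x / d i j)).
  rewrite (_ : (fun x => x / d i j) = (d i j)^-1 \*: id); last first.
    by apply/funext => x /=; rewrite mulrC.
  rewrite -[X in is_derive _ _ _ X]mulr1.
  exact: is_deriveZ.
have cP (x y : R) : 0 < x -> {within `[x, y], continuous P}.
  move=> x0; apply: continuous_in_subspaceT => c; rewrite inE /= in_itv /=.
  move=> /andP[xc _]; apply: differentiable_continuous; apply/derivable1_diffP.
  by have [] := dP c (lt_le_trans x0 xc).
have Pdec (x y : R) : 0 < x -> x <= y -> P y <= P x.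
  move=> x0 xy.
  have [c| |c cxy Pxy] := @MVT_segment R P (fun u => - bform (E u) v v) x y xy.
  - by rewrite in_itv /= => /andP[xc _]; apply: dP; exact: lt_trans xc.
  - exact: cP.
  - by rewrite -subr_le0 Pxy mulNr oppr_le0 mulr_ge0 ?subr_ge0.
have Ple0 (y : R) : 0 < y -> P y <= 0.
  move=> y0; pose B := \sum_i \sum_j `|v i * v j|.
  have B0 : 0 <= B by apply: sumr_ge0 => i _; apply: sumr_ge0.
  have PB (x : R) : 0 < x -> P x <= B * x.
    move=> x0; rewrite mulr_suml; apply: ler_sum => i _.
    rewrite mulr_suml; apply: ler_sum => j _.
    have [->|ij] := eqVneq i j.
      by rewrite d0 mulr0 mul0r mulr_ge0 // ltW.
    have dij := dgt0 _ _ ij.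
    have /andP[G0 Gx] := G0v (x / d i j) (divr_gt0 x0 dij).
    rewrite (le_trans (ler_norm _)) // -mulrA normrM ler_wpM2l //.
    by rewrite ger0_norm ?mulr_ge0 ?(ltW dij) // mulrC -ler_pdivlMr.
  apply/ler_addgt0Pr => e e0; rewrite add0r.
  pose x := Num.min y (e / (B + 1)).
  have B1 : 0 < B + 1 by rewrite ltr_wpDl.
  have x0 : 0 < x by rewrite lt_min y0 divr_gt0.
  have xy : x <= y by rewrite ge_min lexx.
  rewrite (le_trans (Pdec _ _ x0 xy)) // (le_trans (PB _ x0)) //.
  rewrite (@le_trans _ _ ((B + 1) * x)) ?ler_wpM2r ?lerDl ?(ltW x0) //.
  by rewrite mulrC -ler_pdivlMr // ge_min lexx orbT.
have PL : P u @[u --> +oo] --> 0.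
  have <- : \sum_i \sum_j v i * v j * d i j * L = 0.
    transitivity (bform d v v * L); last by rewrite Qv mul0r.
    rewrite mulr_suml; apply: eq_bigr => i _.
    by rewrite mulr_suml; apply: eq_bigr => j _; ring.
  apply: cvg_big => [|i _]; first exact: add_continuous.
  apply: cvg_big => [|j _]; first exact: add_continuous.
  have [->|ij] := eqVneq i j.
    rewrite d0 mulr0 mul0r; under eq_fun do rewrite mul0r.
    exact: cvg_cst.
  apply: cvgMl_tmp; apply: cvg_comp GL.
  by apply: gt0_cvgMly; [rewrite invr_gt0 dgt0|exact: cvg_id].
have PE0 (y : R) : 0 < y -> P y = 0.
  move=> y0; apply/eqP; rewrite eq_le Ple0 //=.
  apply: (cvgr_to_le PL); exists y; split; first exact: num_real.
  by move=> x /ltW; exact: Pdec.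
have Enull (u : R) : 0 < u -> exists2 c, 0 < c < u & bform (E c) v v = 0.
  move=> u0; have u20 : 0 < u / 2 by rewrite divr_gt0.
  have u2u : u / 2 < u by rewrite ltr_pdivrMr // ltr_pMr // ltr1n.
  (* mean value theorem on [u / 2, u], where [P] is constant *)
  have [c| |c cxy Pxy] := @MVT R P (fun u => - bform (E u) v v) _ _ u2u.
  - by rewrite in_itv /= => /andP[xc _]; apply: dP; exact: lt_trans xc.
  - exact: cP.
  - move: cxy; rewrite in_itv /= => /andP[c1 c2].
    exists c; first by rewrite c2 (lt_trans u20).
    move/eqP: Pxy; rewrite !PE0 // subrr eq_sym mulf_eq0 oppr_eq0.
    by rewrite subr_eq0 (gt_eqF u2u) orbF => /eqP.
apply/eqP/negPn/negP => va0.
(* For [c <= 1] the off-diagonal entries of [E c] are at most [c / d i j `^ p], so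
   [bform (E c) v v >= S - c * D]. *)
pose S := \sum_i v i ^+ 2.
have S0 : 0 < S.
  rewrite /S (bigD1 a) //= ltr_wpDr ?exprn_even_gt0 //.
  by apply: sumr_ge0 => i _; exact: sqr_ge0.
pose D := \sum_i \sum_j `|v i * v j| / pdist d p i j.
have pd0 i j : 0 <= pdist d p i j.
  by rewrite /pdist; case: ifP => // _; exact: powR_ge0.
have D0 : 0 <= D.
  by apply: sumr_ge0 => i _; apply: sumr_ge0 => j _; rewrite divr_ge0.
have D1 : 0 < D + 1 by rewrite ltr_wpDl.
pose u := Num.min 1 (S / (D + 1)).
have u0 : 0 < u by rewrite lt_min ltr01 divr_gt0.
have [c /andP[c0]] := Enull u u0.
rewrite lt_min => /andP[c1]; rewrite ltr_pdivlMr // => cD Ec0.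
suff : S - c * D <= bform (E c) v v by rewrite Ec0; lra.
rewrite /S /D mulr_sumr -sumrB; apply: ler_sum => i _.
have -> : v i ^+ 2 = \sum_j (i == j)%:R * (v i * v j).
  rewrite (bigD1 i) //= eqxx mul1r big1 ?addr0 ?expr2 // => j ji.
  by rewrite eq_sym (negbTE ji) mul0r.
rewrite mulr_sumr -sumrB; apply: ler_sum => j _.
rewrite /E /pdist; have [->|ij] := eqVneq i j.
  by rewrite invr0 !mulr0 oppr0 expR0 addr0.
have ep : 0 < d i j `^ p by apply: powR_gt0; exact: dgt0.
rewrite mul0r sub0r lerNl (le_trans (ler_norm _)) // normrN normrM mulrA mulrC.
rewrite -[c * _ / _]mulrA mulrCA ler_wpM2l //.
rewrite ger0_norm ?expR_ge0 // expRN powRN.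
have cp0 : 0 < c `^ p by rewrite powR_gt0.
(* [expR x >= 1 + x >= x] at [x = d i j `^ p / c `^ p], and [c `^ p <= c] *)
rewrite -[leRHS]invrK lef_pV2 ?posrE ?expR_gt0 ?invr_gt0 ?divr_gt0 //.
rewrite (le_trans _ (expR_ge1Dx _)) // ler_wpDl // invf_div mulrC.
by rewrite ler_wpM2r ?(ltW ep) // lef_pV2 ?posrE // ge1r_powR ?c0 ?(ltW c1) ?(ltW p1).
Qed.

(** * Generalized roundness and negative type *)

Lemma bform_suml {R : realType} {I J : finType} (K : I -> I -> R)
    (f : J -> I -> R) w :
  bform K (fun i => \sum_a f a i) w = \sum_a bform K (f a) w.
Proof.
rewrite /bform [RHS]exchange_big /=; apply: eq_bigr => i _.
rewrite [RHS]exchange_big /=; apply: eq_bigr => j _.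
by rewrite -mulr_sumr -mulr_suml.
Qed.

Definition multiplicity {R : realType} {N k : nat} (a : 'I_k -> 'I_N) (x : 'I_N) : R :=
  \sum_(i < k) (x == a i)%:R.

Lemma bform_multiplicity {R : realType} {N k l : nat} (K : 'I_N -> 'I_N -> R)
    (a : 'I_k -> 'I_N) (b : 'I_l -> 'I_N) :
  (forall i j, K i j = K j i) ->
  bform K (multiplicity a) (multiplicity b) = \sum_i \sum_j K (a i) (b j).
Proof.
move=> sK; rewrite bform_suml; apply: eq_bigr => i _.
rewrite (bformC _ _ sK) bform_suml; apply: eq_bigr => j _.
by rewrite bform_delta sK.
Qed.

Lemma sum_multiplicity {R : realType} {N k : nat} (a : 'I_k -> 'I_N) :
  \sum_x multiplicity a x = k%:R :> R.
Proof.
rewrite exchange_big /=; under eq_bigr do rewrite sum_delta.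
by rewrite sumr_const card_ord.
Qed.

Lemma sum_lt_sym {R : realType} {k : nat} (K : 'I_k -> 'I_k -> R) :
  (forall i j, K i j = K j i) -> (forall i, K i i = 0) ->
  \sum_i \sum_j K i j = 2 * \sum_(i < k) \sum_(j < k | (i < j)%N) K i j.
Proof.
move=> sK K0.
have -> : \sum_i \sum_j K i j =
    \sum_(i < k) \sum_(j < k | (i < j)%N) K i j +
    \sum_(i < k) \sum_(j < k | (j < i)%N) K i j.
  rewrite -big_split; apply: eq_bigr => i _ /=.
  rewrite (bigID (fun j : 'I_k => (i < j)%N)) /=; congr (_ + _).
  rewrite (bigD1 i) ?ltnn //= K0 add0r; apply: eq_bigl => j.
  by rewrite -leqNgt ltn_neqAle andbC.
rewrite [X in _ + X](exchange_big_dep xpredT) //=.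
under [X in _ + X]eq_bigr do under eq_bigr do rewrite sK.
by ring.
Qed.

(** Both sides of the roundness inequality count the pairs of entries of the two
    lists, so the inequality is the negative type inequality for the difference
    of the multiplicities. *)
Lemma generalized_roundnessP {R : realType} {N : nat} (d : 'I_N -> 'I_N -> R) p :
  (forall i j, d i j = d j i) ->
  generalized_roundness d p <->
  forall k (a b : 'I_k -> 'I_N),
    bform (pdist d p) (fun x => multiplicity a x + -1 * multiplicity b x)
                      (fun x => multiplicity a x + -1 * multiplicity b x) <= 0.
Proof.
move=> sd; have sK := pdist_sym p sd.
have E k (a b : 'I_k -> 'I_N) :
    bform (pdist d p) (fun x => multiplicity a x + -1 * multiplicity b x)
                      (fun x => multiplicity a x + -1 * multiplicity b x) =
    2 * ((\sum_(i < k) \sum_(j < k | (i < j)%N) pdist d p (a i) (a j) +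
          \sum_(i < k) \sum_(j < k | (i < j)%N) pdist d p (b i) (b j))
         - \sum_(i < k) \sum_(j < k) pdist d p (a i) (b j)).
  rewrite qformDZ // !bform_multiplicity //.
  rewrite (sum_lt_sym (K := fun i j => pdist d p (a i) (a j))) => [|i j|i]; last 2 first.
  - exact: sK.
  - exact: pdist_diag.
  rewrite (sum_lt_sym (K := fun i j => pdist d p (b i) (b j))) => [|i j|i]; last 2 first.
  - exact: sK.
  - exact: pdist_diag.
  by ring.
split=> [gr k a b|gr k a b].
  by rewrite E pmulr_rle0 // subr_le0; exact: gr.
by rewrite -subr_le0 -(@pmulr_rle0 _ 2) // -E.
Qed.

Lemma negative_type_roundness {R : realType} {N : nat} (d : 'I_N -> 'I_N -> R) p :
  (forall i j, d i j = d j i) -> negative_type d p -> generalized_roundness d p.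
Proof.
move=> sd /negative_typeP nt; apply/generalized_roundnessP => // k a b.
by apply: nt; rewrite big_split -mulr_sumr /= !sum_multiplicity mulN1r subrr.
Qed.

Lemma exists_multiplicity (R : realType) {N k : nat} (u : 'I_N -> nat) :
  (\sum_x u x = k)%N ->
  exists a : 'I_k -> 'I_N, forall x, multiplicity a x = (u x)%:R :> R.
Proof.
move=> uk; pose s := flatten [seq nseq (u x) x | x <- enum 'I_N].
have szs : size s == k.
  rewrite size_flatten /shape -map_comp sumnE big_map big_enum /= -uk.
  by apply/eqP; apply: eq_bigr => x _; rewrite size_nseq.
exists (tnth (Tuple szs)) => x.
rewrite /multiplicity -(big_tuple _ _ (Tuple szs) xpredT (fun y => (x == y)%:R)) /=.
rewrite -natr_sum; congr _%:R.
rewrite /s big_flatten big_map big_enum /= (bigD1 x) //= [X in (_ + X)%N]big1.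
  by rewrite big_nseq eqxx iter_addn_0 mul1n addn0.
move=> y yx; rewrite big_nseq eq_sym (negbTE yx).
by rewrite iter_addn_0.
Qed.

Lemma roundness_integer {R : realType} {N : nat} (d : 'I_N -> 'I_N -> R) p
    (z : 'I_N -> int) :
  (forall i j, d i j = d j i) -> generalized_roundness d p ->
  \sum_x z x = 0 ->
  bform (pdist d p) (fun x => (z x)%:~R) (fun x => (z x)%:~R) <= 0.
Proof.
move=> sd /(generalized_roundnessP _ sd) gr z0.
pose u x := if 0 <= z x then `|z x|%N else 0%N.
pose v x := if 0 <= z x then 0%N else `|z x|%N.
have zE x : z x = (u x)%:Z - (v x)%:Z.
  rewrite /u /v; case: ifPn => zx; first by rewrite gez0_abs // subr0.
  by rewrite sub0r ltz0_abs ?opprK // ltNge.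
have uv : (\sum_x v x = \sum_x u x)%N.
  apply/eqP; rewrite -eqz_nat -subr_eq0 -opprB oppr_eq0; apply/eqP.
  rewrite -z0 !(raddf_sum (Posz : nat -> int)) -sumrB; apply: eq_bigr => x _.
  by rewrite zE.
have [a aE] := exists_multiplicity R (erefl (\sum_x u x)%N).
have [b bE] := exists_multiplicity R uv.
have := gr _ a b; congr (_ <= _); apply: eq_bigr => x _; apply: eq_bigr => y _.
by rewrite !aE !bE !zE !rmorphB /= !pmulrn; ring.
Qed.

Lemma ler_norm_bform {R : realType} {I : finType} (K : I -> I -> R) (u v : I -> R)
    (U V : R) : (forall i, `|u i| <= U) -> (forall i, `|v i| <= V) ->
  `|bform K u v| <= (\sum_i \sum_j `|K i j|) * (U * V).
Proof.
move=> hu hv; rewrite mulr_suml (le_trans (ler_norm_sum _ _ _)) //.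
apply: ler_sum => i _; rewrite mulr_suml (le_trans (ler_norm_sum _ _ _)) //.
by apply: ler_sum => j _; rewrite !normrM ler_wpM2l // ler_pM.
Qed.

(** For real [v] of sum zero, round [n v] to an integer vector of sum zero: the
    error is bounded independently of [n], so the form changes by [O(n)] only,
    while it is [n ^ 2] times its value at [v]. *)
Lemma roundness_negative_type {R : realType} {N : nat} (d : 'I_N -> 'I_N -> R) p :
  (forall i j, d i j = d j i) -> generalized_roundness d p -> negative_type d p.
Proof.
move=> sd gr; apply/negative_typeP => v v0.
have sK := pdist_sym p sd.
case: N d v v0 sd gr sK => [|N] d v v0 sd gr sK; first by rewrite /bform big_ord0.
pose q := pdist d p; rewrite -/q.
pose M : R := \sum_i `|v i|.
pose B : R := \sum_i \sum_j `|q i j|.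
have vM i : `|v i| <= M.
  by rewrite /M (bigD1 i) //= lerDl sumr_ge0.
pose C := 2 * (B * (M * N.+1%:R)) + B * (N.+1%:R * N.+1%:R).
have bound n : n.+1%:R * bform q v v <= C.
  (* The coordinate at [ord0] absorbs the rounding errors of all others. *)
  pose fl i := Num.floor (n.+1%:R * v i).
  pose z i := if i == ord0 then - \sum_(j | j != ord0) fl j else fl i.
  have z0 : \sum_i z i = 0.
    rewrite (bigD1 ord0) //= {1}/z eqxx addrC; apply/eqP; rewrite subr_eq0.
    by apply/eqP; apply: eq_bigr => i /negbTE i0; rewrite /z i0.
  pose r i : R := (z i)%:~R - n.+1%:R * v i.
  have r1 i : i != ord0 -> `|r i| <= 1.
    move=> /negbTE i0; rewrite /r /z i0 distrC ler_norml.
    have := floor_itv (n.+1%:R * v i); rewrite -/(fl i) rmorphD /=; lra.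
  have rN i : `|r i| <= N.+1%:R.
    have [->|i0] := eqVneq i ord0; last first.
      by rewrite (le_trans (r1 _ i0)) // ler1n.
    have -> : r ord0 = - \sum_(j | j != ord0) r j.
      apply/eqP; rewrite -addr_eq0; apply/eqP.
      have : \sum_i r i = 0 by rewrite sumrB -mulr_sumr v0 mulr0 subr0 -rmorph_sum z0.
      by rewrite (bigD1 ord0).
    rewrite normrN (le_trans (ler_norm_sum _ _ _)) //.
    rewrite (le_trans (ler_sum _ r1)) // sumr_const ler_nat.
    by rewrite (leq_trans (max_card _)) // card_ord.
  have := roundness_integer sd gr z0; rewrite -/q.
  rewrite (_ : (fun x => (z x)%:~R) = fun x => r x + n.+1%:R * v x); last first.
    by apply/funext => x; rewrite /r subrK.
  rewrite qformDZ // (bformC r v sK) => h.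
  have h1 : - bform q v r <= B * (M * N.+1%:R).
    by rewrite (le_trans (ler_norm _)) // normrN; exact: ler_norm_bform.
  have h2 : - bform q r r <= B * (N.+1%:R * N.+1%:R).
    by rewrite (le_trans (ler_norm _)) // normrN; exact: ler_norm_bform.
  have n0 : 0 < n.+1%:R :> R by rewrite ltr0n.
  have n1 : 1 <= n.+1%:R :> R by rewrite ler1n.
  rewrite -(ler_pM2l n0) /C.
  have h3 := ler_wpM2l (ltW n0) h1.
  have h4 : 0 <= B * (N.+1%:R * N.+1%:R).
    by rewrite mulr_ge0 ?mulr_ge0 // sumr_ge0 // => i _; rewrite sumr_ge0.
  have h5 := ler_wpM2r h4 n1.
  rewrite mul1r in h5; rewrite expr2 in h.
  rewrite mulrDr; lra.
rewrite leNgt; apply/negP => Q0.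
have := bound (Num.bound (C / bform q v v)).
have C0 : 0 <= C.
  have B0 : 0 <= B by rewrite sumr_ge0 // => i _; rewrite sumr_ge0.
  have M0 : 0 <= M by rewrite sumr_ge0.
  by rewrite addr_ge0 // !mulr_ge0.
rewrite -ler_pdivlMr // leNgt => /negP; apply.
have := archi_boundP (divr_ge0 C0 (ltW Q0)); move/lt_le_trans; apply.
by rewrite ler_nat.
Qed.

Lemma maximal_generalized_roundnessE {R : realType} {N : nat}
    (d : 'I_N -> 'I_N -> R) :
  (forall i j, d i j = d j i) ->
  maximal_generalized_roundness d = supremal_negative_type d.
Proof.
move=> sd; congr (ereal_sup (_ @` _)); apply/seteqP; split=> p [p0 h]; split=> //.
  exact: roundness_negative_type.
exact: negative_type_roundness.
Qed.

(** * Strictness, invertibility and gap in a finite metric space *)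

Section FiniteMetric.
Context {R : realType} {N : nat}.
Variable d : 'I_N -> 'I_N -> R.
Hypothesis sd : forall i j, d i j = d j i.
Hypothesis d0 : forall i, d i i = 0.
Hypothesis dgt0 : forall i j, i != j -> 0 < d i j.

(** A kernel vector [u] of the distance matrix whose sum is not [0] could be used
    to move [e_a + e_b] into the hyperplane of sum zero without changing the
    value [2 d(a, b) > 0] of the form. *)
Lemma strict_negative_type_unitmx (a b : 'I_N) : a != b ->
  strict_negative_type d 1 -> dist_mx d 1 \in unitmx.
Proof.
move=> ab /strict_negative_typeP[/negative_typeP]; rewrite pdist1 // => nt nondeg.
rewrite -row_free_unit -kermx_eq0; apply/rowV0P => u /sub_kermxP uD.
pose v (i : 'I_N) : R := u 0 i.
have vD z : bform d v z = 0.
  rewrite /bform exchange_big /= big1 // => j _.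
  have /matrixP/(_ 0 j) := uD; rewrite !mxE => h.
  rewrite (eq_bigr (fun i => u 0 i * dist_mx d 1 i j * z j)) => [|i _].
    by rewrite -mulr_suml h mul0r.
  by rewrite mxE pdist1 // /v; ring.
pose s := \sum_i v i.
have [s0|s0] := eqVneq s 0.
  by apply/rowP => i; rewrite mxE; exact: (nondeg v).
pose e i : R := (i == a)%:R + 1 * (i == b)%:R.
have e_sum : \sum_i (e i + (- (2 / s)) * v i) = 0.
  rewrite big_split -mulr_sumr /= -/s big_split -mulr_sumr /= !sum_delta.
  by field.
have := nt _ e_sum.
rewrite qformDZ // !(bformC e v sd) !vD qformDZ // !bform_delta !d0.
by move=> h; exfalso; move: h (dgt0 ab); clear; lra.
Qed.

(** For fixed finitely many distances, [d `^ p] is continuous in [p], so a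
    positive gap leaves room to increase the exponent. *)
Lemma gap_constant_negative_type_gt1 (c : R) : 0 < c -> gap_constant d 1 c ->
  exists2 p : R, 1 < p & negative_type d p.
Proof.
move=> c0 [_ gapc].
pose g (p : R) : R := \sum_i \sum_j `|pdist d p i j - pdist d 1 i j|.
have g1 : g p @[p --> (1 : R)] --> (0 : R).
  have <- : g 1 = 0.
    by rewrite /g big1 // => i _; rewrite big1 // => j _; rewrite subrr normr0.
  apply: cvg_big => [|i _]; first exact: add_continuous.
  apply: cvg_big => [|j _]; first exact: add_continuous.
  apply: cvg_norm; apply: cvgB; last exact: cvg_cst.
  rewrite /pdist; case: ifPn => [_|ij]; first exact: cvg_cst.
  rewrite /powR gt_eqF ?dgt0 //.
  apply: continuous_cvg; first exact: continuous_expR.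
  by apply: cvgMr_tmp; exact: cvg_id.
have gc : \forall p \near (1 : R)^'+, g p < c / 2.
  apply: (cvgr_lt (0 : R)); last by rewrite divr_gt0.
  exact: cvg_at_right_filter.
near ((1 : R)^'+) => p.
exists p; first by near: p; exact: nbhs_right_gt.
move=> xi /gapc; rewrite !inner_dist_mx.
set v := fun i => xi i 0 => gapv.
have vl i : `|v i| <= l1norm xi by rewrite /l1norm (bigD1 i) //= lerDl sumr_ge0.
have := ler_norm_bform (fun i j => pdist d p i j - pdist d 1 i j) vl vl.
rewrite -/(g p) bform_kerneldiff => /(le_trans (ler_norm _)).
have gp : g p < c / 2 by near: p.
have := ler_wpM2r (sqr_ge0 (l1norm xi)) (ltW gp).
rewrite -expr2; lra.
Unshelve. all: end_near. Qed.

(** The gap constants form a closed set; a vector [e_a - e_b] bounds it from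
    above. *)
Lemma gap_exists (a b : 'I_N) (c : R) : a != b -> 0 < c -> gap_constant d 1 c ->
  exists G : R, is_negative_type_gap d 1 G /\ 0 < G.
Proof.
move=> ab c0 gapc.
pose S := [set G : R | gap_constant d 1 G].
have Sle (xi : 'cV[R]_N) G : F0 xi -> xi != 0 -> S G ->
    G <= - (2 * inner (dist_mx d 1 *m xi) xi) / l1norm xi ^+ 2.
  move=> xi0 xin0 [_ /(_ _ xi0)] h.
  have l0 : 0 < l1norm xi.
    have [i xii] : exists i, xi i 0 != 0.
      apply/existsP; apply: contraR xin0 => /existsPn h0.
      by apply/eqP/colP => i; rewrite mxE; apply/eqP; have := h0 i; rewrite negbK.
    by rewrite /l1norm (bigD1 i) //= ltr_wpDr ?normr_gt0 // sumr_ge0.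
  by rewrite ler_pdivlMr ?exprn_gt0 //; lra.
have Sub : has_ubound S.
  pose xi : 'cV[R]_N := \col_i ((i == a)%:R + -1 * (i == b)%:R).
  have xi0 : F0 xi.
    by apply: F0_col; rewrite big_split -mulr_sumr /= !sum_delta mulN1r subrr.
  have xin0 : xi != 0.
    apply/eqP => /colP/(_ a)/eqP; rewrite !mxE eqxx (negbTE ab) mulr0 addr0.
    by rewrite oner_eq0.
  by exists (- (2 * inner (dist_mx d 1 *m xi) xi) / l1norm xi ^+ 2) => G; exact: Sle.
have csup : c <= sup S by exact: ub_le_sup.
exists (sup S); split; last exact: lt_le_trans csup.
split; last by move=> G SG; exact: ub_le_sup.
split=> [|xi xi0]; first exact: le_trans (ltW c0) csup.
have [->|xin0] := eqVneq xi 0.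
  rewrite /inner /l1norm big1 => [|i _]; last by rewrite mxE normr0.
  by rewrite big1 => [|i _]; rewrite ?mxE ?mulr0 // expr0n mulr0 add0r.
have : sup S <= - (2 * inner (dist_mx d 1 *m xi) xi) / l1norm xi ^+ 2.
  by apply: ge_sup; [exists c|move=> G; exact: Sle].
have [l0|l0] := eqVneq (l1norm xi ^+ 2) 0.
  by case: gapc => _ /(_ _ xi0); rewrite l0 !mulr0.
have lgt0 : 0 < l1norm xi ^+ 2 by rewrite lt_neqAle eq_sym l0 sqr_ge0.
by rewrite ler_pdivlMr //; lra.
Qed.

End FiniteMetric.

(** * Subsets of the weighted Hamming cube *)

Lemma affinely_independentP {R : realType} {n m : nat} (x : 'I_m.+1 -> 'cV[R]_n) :
  affinely_independent x <->
  forall v : 'I_m.+1 -> R, \sum_i v i = 0 -> \sum_i v i *: x i = 0 ->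
    forall i, v i = 0.
Proof.
pose f (i : 'I_m) := x (lift ord0 i) - x ord0.
have sumE (k : 'I_m -> R) :
    \sum_(i < m) k i *: (mktuple f)`_i =
    (- \sum_i k i) *: x ord0 + \sum_i k i *: x (lift ord0 i).
  rewrite scaleNr scaler_suml addrC -sumrB; apply: eq_bigr => i _.
  by rewrite -tnth_nth tnth_mktuple scalerBr.
have freeE := @freeP _ _ _ (mktuple f).
split=> [/freeE fr v v0 vx|h].
  pose k i := v (lift ord0 i).
  have vE : v ord0 = - \sum_i k i.
    by apply/eqP; rewrite -addr_eq0; apply/eqP; rewrite -[RHS]v0 big_ord_recl.
  have k0 : forall i, k i = 0.
    by apply: fr; rewrite sumE -vE -[RHS]vx big_ord_recl.
  move=> i; case: (unliftP ord0 i) => [j ->|->]; first exact: k0.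
  by rewrite vE big1 ?oppr0.
apply/freeE => k; rewrite sumE => k0 i.
pose v j := if unlift ord0 j is Some l then k l else - \sum_i k i.
have := h v; rewrite !big_ord_recl /v unlift_none.
under [X in _ + X = _ -> _]eq_bigr do rewrite liftK.
under [X in _ -> _ *: _ + X = _ -> _]eq_bigr do rewrite liftK.
by rewrite addNr => /(_ erefl k0 (lift ord0 i)); rewrite liftK.
Qed.

Section Cube.
Context {R : realType} {n N : nat}.
Variables (w : 'I_n -> R) (x : 'I_N -> 'cV[R]_n).
Hypothesis w_gt0 : forall k, 0 < w k.
Hypothesis x_inj : injective x.
Hypothesis x_cube : forall i, hamming_cube w (x i).

Let d (i j : 'I_N) : R := l1norm (x i - x j).
Let y (v : 'I_N -> R) (k : 'I_n) : R := \sum_j v j * x j k 0.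

Lemma l1dist_sym i j : d i j = d j i.
Proof. by apply: eq_bigr => k _; rewrite !mxE distrC. Qed.

Lemma l1dist_diag i : d i i = 0.
Proof. by rewrite /d subrr /l1norm big1 // => k _; rewrite mxE normr0. Qed.

Lemma l1dist_gt0 i j : i != j -> 0 < d i j.
Proof.
move=> ij; have [k xk] : exists k, x i k 0 != x j k 0.
  apply/existsP; apply: contraR ij => /existsPn h0; apply/eqP/x_inj/colP => k.
  by apply/eqP; have := h0 k; rewrite negbK.
rewrite /d /l1norm (bigD1 k) //= ltr_wpDr ?sumr_ge0 // normr_gt0 !mxE.
by rewrite subr_eq0.
Qed.

(** A coordinate takes two values only, so its contribution to the distance is
    bilinear up to terms in one of the two points: [|s - t| = s + t - 2 s t / w]
    for [s, t] in [{0, w}]. *)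
Lemma cube_distE i j :
  d i j = \sum_k (x i k 0 + x j k 0 - 2 * (x i k 0 * x j k 0) / w k).
Proof.
apply: eq_bigr => k _; rewrite !mxE.
have wk := w_gt0 k; have wk0 := gt_eqF wk.
have [->|->] := x_cube i k; have [->|->] := x_cube j k.
- by rewrite subrr normr0 mulr0; field; rewrite wk0.
- by rewrite sub0r normrN gtr0_norm //; field; rewrite wk0.
- by rewrite subr0 gtr0_norm //; field; rewrite wk0.
- by rewrite subrr normr0; field; rewrite wk0.
Qed.

Lemma cube_dist_mxE v i : \sum_j v j = 0 ->
  \sum_j d i j * v j = \sum_k y v k * (1 - 2 * x i k 0 / w k).
Proof.
move=> v0; under eq_bigr do rewrite cube_distE mulr_suml.
rewrite exchange_big /=; apply: eq_bigr => k _.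
transitivity (x i k 0 * (\sum_j v j) + y v k * (1 - 2 * x i k 0 / w k)).
  by rewrite mulr_sumr /y mulr_suml -big_split; apply: eq_bigr => j _ /=; ring.
by rewrite v0 mulr0 add0r.
Qed.

(** This is the Euclidean nature of [d]: with coordinates rescaled by
    [w k `^ (- 1/2)], the distance is the square of the Euclidean one. *)
Lemma cube_formE v : \sum_j v j = 0 ->
  bform d v v = - 2 * \sum_k y v k ^+ 2 / w k.
Proof.
move=> v0.
transitivity (\sum_i v i * \sum_j d i j * v j).
  by apply: eq_bigr => i _; rewrite mulr_sumr; apply: eq_bigr => j _; ring.
under eq_bigr do rewrite cube_dist_mxE // mulr_sumr.
rewrite exchange_big mulr_sumr /=; apply: eq_bigr => k _.
have E t : \sum_j v j * (t * (1 - 2 * x j k 0 / w k)) =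
    t * (\sum_j v j) - 2 / w k * t * \sum_j v j * x j k 0.
  by rewrite !mulr_sumr -sumrB; apply: eq_bigr => j _; ring.
by rewrite E v0 -/(y v k); ring.
Qed.

Lemma cube_form_le0 v : \sum_j v j = 0 -> bform d v v <= 0.
Proof.
move=> /cube_formE ->; rewrite mulNr oppr_le0 mulr_ge0 // sumr_ge0 // => k _.
by rewrite divr_ge0 ?sqr_ge0 // ltW.
Qed.

Lemma cube_form_eq0 v : \sum_j v j = 0 ->
  bform d v v = 0 <-> \sum_j v j *: x j = 0.
Proof.
move=> v0; have yE k : (\sum_j v j *: x j) k 0 = y v k.
  by rewrite summxE; apply: eq_bigr => j _; rewrite mxE.
rewrite cube_formE //; split=> [/eqP|vx].
  rewrite mulf_eq0 oppr_eq0 pnatr_eq0 /= psumr_eq0 => [/allP h|k _]; last first.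
    by rewrite divr_ge0 ?sqr_ge0 // ltW.
  apply/colP => k; rewrite yE mxE; have := h k (mem_index_enum k).
  by rewrite mulf_eq0 invr_eq0 (gt_eqF (w_gt0 k)) orbF sqrf_eq0 => /eqP.
by rewrite big1 ?mulr0 // => k _; rewrite -yE vx mxE expr0n mul0r.
Qed.

Lemma cube_negative_type : negative_type d 1.
Proof.
apply/negative_typeP => v v0; rewrite pdist1; first exact: cube_form_le0.
  exact: l1dist_diag.
exact: l1dist_gt0.
Qed.

(** The terms [1 - 2 * x i k 0 / w k] of [cube_dist_mxE] show that [y v = 0] forces
    [D v = 0]: a vector on which the form vanishes is in the kernel of [D]. *)
Lemma cube_unitmx_strict_negative_type :
  dist_mx d 1 \in unitmx -> strict_negative_type d 1.
Proof.
have p1 : pdist d 1 = d by apply: pdist1; [exact: l1dist_diag|exact: l1dist_gt0].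
move=> uD; apply/strict_negative_typeP; split; first exact: cube_negative_type.
rewrite p1 => v v0 /(cube_form_eq0 v0) vx i.
have Dv : dist_mx d 1 *m (\col_i v i) = 0.
  apply/colP => j; rewrite !mxE.
  transitivity (\sum_l d j l * v l).
    by apply: eq_bigr => l _; rewrite !mxE p1.
  rewrite cube_dist_mxE // big1 // => k _.
  have -> : y v k = (\sum_j v j *: x j) k 0.
    by rewrite summxE; apply: eq_bigr => l _; rewrite mxE.
  by rewrite vx mxE mul0r.
have := mulKmx uD (\col_i v i); rewrite Dv mulmx0 => /colP/(_ i).
by rewrite !mxE.
Qed.

(** When [D] is invertible, [v = D^-1 (D v)] bounds [v] by the vector [y], each
    entry of [D v] being a sum of the [y k] with signs, while [bform d v v]
    dominates the weighted square norm of [y]. *)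
Lemma cube_unitmx_gap : dist_mx d 1 \in unitmx ->
  exists2 c, 0 < c & gap_constant d 1 c.
Proof.
have p1 : pdist d 1 = d by apply: pdist1; [exact: l1dist_diag|exact: l1dist_gt0].
move=> uD.
pose beta := \sum_i \sum_j `|invmx (dist_mx d 1) i j|.
pose W := \sum_k w k.
have W0 : 0 <= W by rewrite sumr_ge0 // => k _; exact: ltW.
have C1 : 0 < beta ^+ 2 * W + 1 by rewrite ltr_wpDl // mulr_ge0 ?sqr_ge0.
exists (4 / (beta ^+ 2 * W + 1)); first by rewrite divr_gt0.
split=> [|xi /F0E xi0]; first by rewrite divr_ge0 // ltW.
pose v i := xi i 0.
rewrite inner_dist_mx p1 cube_formE // -/v.
set S := \sum_k _.
have S0 : 0 <= S.
  by rewrite sumr_ge0 // => k _; rewrite divr_ge0 ?sqr_ge0 // ltW.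
pose Y := \sum_k `|y v k|.
have YS : Y ^+ 2 <= W * S.
  (* Cauchy-Schwarz, by symmetrizing the double sum [W * S] *)
  have sym : W * S + S * W = 2 * (W * S) by ring.
  rewrite -(ler_pM2l (ltr0n R 2)) -sym expr2 !mulr_suml mulr_sumr -big_split.
  apply: ler_sum => k _ /=; rewrite !mulr_sumr -big_split.
  apply: ler_sum => l _ /=.
  have wk := w_gt0 k; have wl := w_gt0 l.
  rewrite -subr_ge0.
  suff -> : w k * (y v l ^+ 2 / w l) + y v k ^+ 2 / w k * w l -
      2 * (`|y v k| * `|y v l|) =
      (w k * `|y v l| - w l * `|y v k|) ^+ 2 / (w k * w l).
    by rewrite divr_ge0 ?sqr_ge0 // mulr_ge0 // ltW.
  rewrite -[y v l ^+ 2]real_normK ?num_real // -[y v k ^+ 2]real_normK ?num_real //.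
  by field; rewrite !gt_eqF.
have lY : l1norm xi <= beta * Y.
  rewrite /l1norm mulr_suml; apply: ler_sum => i _.
  rewrite -[xi](mulKmx uD) mxE (le_trans (ler_norm_sum _ _ _)) // mulr_suml.
  apply: ler_sum => j _; rewrite normrM ler_wpM2l //.
  have -> : (dist_mx d 1 *m xi) j 0 = \sum_l d j l * v l.
    by rewrite mxE; apply: eq_bigr => l _; rewrite mxE p1.
  rewrite cube_dist_mxE // (le_trans (ler_norm_sum _ _ _)) //.
  apply: ler_sum => k _; rewrite normrM ler_piMr //.
  have wk0 := gt_eqF (w_gt0 k).
  have [->|->] := x_cube j k; first by rewrite mulr0 mul0r subr0 normr1.
  have -> : 1 - 2 * w k / w k = -1 by field; rewrite wk0.
  by rewrite normrN normr1.
have l0 : 0 <= l1norm xi by rewrite sumr_ge0.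
have l2 : l1norm xi ^+ 2 <= (beta ^+ 2 * W + 1) * S.
  rewrite mulrDl mul1r (@le_trans _ _ (beta ^+ 2 * (W * S))) //; last first.
    by rewrite mulrA lerDl.
  rewrite (@le_trans _ _ ((beta * Y) ^+ 2)) ?lerXn2r ?nnegrE ?(le_trans l0 lY) //.
  by rewrite exprMn ler_wpM2l ?sqr_ge0.
have l4 : l1norm xi ^+ 2 / (beta ^+ 2 * W + 1) <= S by rewrite ler_pdivrMr // mulrC.
rewrite mulrAC -mulrA; lra.
Qed.

End Cube.

Theorem theorem1p1 (R : realType) (n : nat) (w : 'I_n -> R)
    (w_gt0 : forall k : 'I_n, 0 < w k)
    (m : nat) (m_gt0 : (0 < m)%N) (x : 'I_m.+1 -> 'cV[R]_n)
    (x_inj : injective x)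
    (x_cube : forall i : 'I_m.+1, hamming_cube w (x i)) :
  let d := fun i j : 'I_m.+1 => l1norm (x i - x j) in
  [<-> affinely_independent x;
       dist_mx d 1 \in unitmx;
       strict_negative_type d 1;
       (1%:E < supremal_negative_type d)%E;
       (1%:E < maximal_generalized_roundness d)%E;
       (exists G : R, is_negative_type_gap d 1 G /\ 0 < G);
       ~ nontrivial_polygonal_equality d 1].
Proof.
move=> d.
have sd : forall i j, d i j = d j i by exact: l1dist_sym.
have d0 : forall i, d i i = 0 by exact: l1dist_diag.
have dgt0 : forall i j, i != j -> 0 < d i j by exact: l1dist_gt0.
have ab : ord0 != ord_max :> 'I_m.+1 by rewrite -val_eqE /= eq_sym -lt0n.
have p1 : pdist d 1 = d by exact: pdist1.
have nt1 : negative_type d 1 := cube_negative_type w_gt0 x_inj x_cube.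
have unit_strict := cube_unitmx_strict_negative_type w_gt0 x_inj x_cube.
have strict_gap : strict_negative_type d 1 -> exists2 c, 0 < c & gap_constant d 1 c.
  move=> /(strict_negative_type_unitmx sd d0 dgt0 ab).
  exact: (cube_unitmx_gap w_gt0 x_inj x_cube).
tfae.
- move=> /affinely_independentP ai.
  apply: (strict_negative_type_unitmx sd d0 dgt0 ab); apply/strict_negative_typeP.
  by split=> //; rewrite p1 => v v0 /(cube_form_eq0 w_gt0 x_cube v0); exact: ai.
- exact: unit_strict.
- move=> /strict_gap[c c0 /(gap_constant_negative_type_gt1 dgt0 c0)[p p_gt1 ntp]].
  apply: (@lt_le_trans _ _ p%:E); first by rewrite lte_fin.
  by apply: ereal_sup_ubound; exists p => //; split => //; lra.
- by rewrite maximal_generalized_roundnessE.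
- rewrite maximal_generalized_roundnessE // => /ereal_sup_gt[_ [p [_ ntp] <-]].
  rewrite lte_fin => p_gt1.
  have /strict_gap[c c0 gapc] : strict_negative_type d 1.
    apply/strict_negative_typeP; split=> //; rewrite p1.
    exact: (negative_type_gt1_nondegenerate sd d0 dgt0 p_gt1 ntp).
  exact: gap_exists ab c0 gapc.
- move=> [G [[[_ gapG] _] G0]] [xi [xi0 xin0 Q0]].
  have := gapG xi xi0; rewrite Q0 mulr0 addr0 pmulr_rle0 // => l0.
  have l00 : l1norm xi = 0.
    by apply/eqP; rewrite -sqrf_eq0 eq_le l0 sqr_ge0.
  apply: xin0; apply/colP => i; rewrite mxE; apply/eqP; rewrite -normr_eq0.
  by move/eqP: l00; rewrite psumr_eq0 // => /allP/(_ i (mem_index_enum i)).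
- move=> nopoly; apply/affinely_independentP => v v0 vx i.
  apply/eqP/negPn/negP => vi; apply: nopoly; exists (\col_i v i); split.
  + exact: F0_col.
  + by move=> /matrixP/(_ i 0)/eqP; rewrite !mxE (negbTE vi).
  + by rewrite inner_dist_mx_col p1; apply/(cube_form_eq0 w_gt0 x_cube v0).
Qed.
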